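(* Let $\mathcal{G}_1$ and $\mathcal{G}_2$ be two maximal ancestral graphs (MAGs) on the same vertex set $\mathcal{V}$. Then $\mathcal{G}_1$ and $\mathcal{G}_2$ are Markov equivalent if and only if $\mathcal{S}(\mathcal{G}_1)=\mathcal{S}(\mathcal{G}_2)$.
   Context: An acyclic directed mixed graph (ADMG) $\mathcal{G}$ on a finite vertex set $\mathcal{V}$ has edges of two kinds, directed ($a\to b$) and bidirected ($a\leftrightarrow b$), and has no directed cycle. For $v\in\mathcal{V}$: $\mathrm{pa}_{\mathcal{G}}(v)=\{w: w\to v\}$; $\mathrm{sib}_{\mathcal{G}}(v)=\{w: w\leftrightarrow v\}$; $\mathrm{an}_{\mathcal{G}}(v)$ is $v$ together with all $w$ having a directed path $w\to\cdots\to v$; $\mathrm{de}_{\mathcal{G}}(v)$ is $v$ together with all $w$ having a directed path $v\to\cdots\to w$; $\mathrm{dis}_{\mathcal{G}}(v)$ (the district of $v$) is $v$ together with all $w$ joined to $v$ by a path consisting only of bidirected edges. For a set $W$ these operators are the union over $w\in W$. For $W\subseteq\mathcal{V}$, $\mathcal{G}_W$ is the induced subgraph on $W$ and $\mathrm{dis}_W(v)$ denotes the district of $v$ in $\mathcal{G}_W$ (union over elements for sets). A path is a sequence of distinct vertices in which consecutive vertices are joined by an edge. A non-endpoint vertex $w$ of a path is a collider on it if both path edges at $w$ have an arrowhead at $w$ (each is $\to w$ or $\leftrightarrow w$); otherwise it is a noncollider. For vertices $a,b$ and a set $C$ with $a,b\notin C$, a path between $a$ and $b$ is m-connecting given $C$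 if every noncollider on it is not in $C$ and every collider on it is in $\mathrm{an}_{\mathcal{G}}(C)$. For disjoint sets $A,B,C$ with $A,B$ nonempty, $A$ and $B$ are m-separated by $C$ if there is no m-connecting path given $C$ between any $a\in A$ and $b\in B$. Two vertices are adjacent if joined by an edge. $\mathcal{G}$ is maximal if every pair of nonadjacent vertices is m-separated by some set; it is ancestral if $\mathrm{sib}_{\mathcal{G}}(v)\cap\mathrm{an}_{\mathcal{G}}(v)=\emptyset$ for all $v$. A MAG is a maximal ancestral ADMG. Two graphs on the same vertex set are Markov equivalent if exactly the same m-separation statements hold in both. For $W\subseteq\mathcal{V}$, $\mathrm{barren}_{\mathcal{G}}(W)=\{w\in W:\mathrm{de}_{\mathcal{G}}(w)\cap W=\{w\}\}$. A set $H\subseteq\mathcal{V}$ is a head if $\mathrm{barren}_{\mathcal{G}}(H)=H$ and $H$ is contained in a single district of $\mathcal{G}_{\mathrm{an}_{\mathcal{G}}(H)}$; $\mathcal{H}(\mathcal{G})$ is the set of heads. The tail of a head is $\mathrm{tail}(H)=(\mathrm{dis}_{\mathrm{an}(H)}(H)\setminus H)\cup\mathrm{pa}_{\mathcal{G}}(\mathrm{dis}_{\mathrm{an}(H)}(H))$, where $\mathrm{an}(H)=\mathrm{an}_{\mathcal{G}}(H)$. The parametrizing set is $\mathcal{S}(\mathcal{G})=\{H\cup A: H\in\mathcal{H}(\mathcal{G}),\ A\subseteq\mathrm{tail}(H)\}$. *)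

(* Defs.v *)
From mathcomp Require Import all_boot.

Set Implicit Arguments.
Unset Strict Implicit.
Unset Printing Implicit Defensive.

(* The same pair of vertices may carry both a directed and a bidirected edge. *)
Record admg (V : finType) := ADMG {
  dir : rel V;
  bidir : rel V;
  bidir_sym : symmetric bidir;
  bidir_irr : irreflexive bidir;
  dir_acyclic : forall c : seq V, cycle dir c -> c = [::]
}.

(* The induced subgraph G_W is represented on the ambient type V: vertices
   outside W become isolated, so the operators below have their usual meaning
   in G_W at the vertices of W. *)
Section Induced.
Variables (V : finType) (G : admg V) (W : {set V}).

Definition induced_dir : rel V :=
  [rel x y | [&& x \in W, y \in W & dir G x y]].
Definition induced_bidir : rel V :=
  [rel x y | [&& x \in W, y \in W & bidir G x y]].

Lemma induced_bidir_sym : symmetric induced_bidir.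
Proof. by move=> x y; rewrite /induced_bidir /= [bidir G x y]bidir_sym andbCA. Qed.

Lemma induced_bidir_irr : irreflexive induced_bidir.
Proof. by move=> x; rewrite /induced_bidir /= (bidir_irr G) !andbF. Qed.

Lemma induced_dir_acyclic (c : seq V) : cycle induced_dir c -> c = [::].
Proof.
move=> cyc; apply: (@dir_acyclic V G); apply: sub_cycle cyc.
by move=> x y /= /and3P[].
Qed.

Definition induced : admg V :=
  ADMG induced_bidir_sym induced_bidir_irr induced_dir_acyclic.

End Induced.

Section Operators.
Variables (V : finType) (G : admg V).

Definition pa1 (v : V) : {set V} := [set w | dir G w v].
Definition sib1 (v : V) : {set V} := [set w | bidir G w v].
Definition an1 (v : V) : {set V} := [set w | connect (dir G) w v].
Definition de1 (v : V) : {set V} := [set w | connect (dir G) v w].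
Definition dis1 (v : V) : {set V} := [set w | connect (bidir G) v w].

Definition pa (W : {set V}) : {set V} := \bigcup_(w in W) pa1 w.
Definition an (W : {set V}) : {set V} := \bigcup_(w in W) an1 w.
Definition dis (W : {set V}) : {set V} := \bigcup_(w in W) dis1 w.

Definition adjacent (a b : V) : bool := [|| dir G a b, dir G b a | bidir G a b].

End Operators.

(* An edge as traversed along a path from x to y:
   Fwd is x -> y, Bwd is x <- y and Bid is x <-> y. *)
Variant edge_kind := Fwd | Bwd | Bid.

Definition arrowhead_at_source (e : edge_kind) : bool :=
  match e with Fwd => false | Bwd | Bid => true end.
Definition arrowhead_at_target (e : edge_kind) : bool :=
  match e with Bwd => false | Fwd | Bid => true end.

Section MSeparation.
Variables (V : finType) (G : admg V).

Definition edge (x : V) (e : edge_kind) (y : V) : bool :=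
  match e with
  | Fwd => dir G x y
  | Bwd => dir G y x
  | Bid => bidir G x y
  end.

(* A path from a is given by the list of its successive steps, each recording
   the edge that is used and the vertex it leads to. *)
Fixpoint is_walk (a : V) (p : seq (edge_kind * V)) : bool :=
  if p is (e, y) :: q then edge a e y && is_walk y q else true.

Definition is_path (a b : V) (p : seq (edge_kind * V)) : bool :=
  [&& is_walk a p, uniq (a :: unzip2 p) & last a (unzip2 p) == b].

Definition collider (e1 e2 : edge_kind) : bool :=
  arrowhead_at_target e1 && arrowhead_at_source e2.

Fixpoint inner_open (C : {set V}) (p : seq (edge_kind * V)) : bool :=
  match p with
  | (e1, w) :: (((e2, _) :: _) as q) =>
      (if collider e1 e2 then w \in an G C else w \notin C) && inner_open C q
  | _ => true
  end.

Definition m_connecting (C : {set V}) (a b : V) (p : seq (edge_kind * V)) : bool :=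
  is_path a b p && inner_open C p.

Definition m_separated (A B C : {set V}) : Prop :=
  [/\ A != set0 /\ B != set0,
      [disjoint A & B], [disjoint A & C], [disjoint B & C] &
      forall a b : V, a \in A -> b \in B ->
        ~ exists p : seq (edge_kind * V), m_connecting C a b p].

Definition maximal : Prop :=
  forall a b : V, a != b -> ~~ adjacent G a b ->
    exists C : {set V}, m_separated [set a] [set b] C.

Definition ancestral : Prop :=
  forall v : V, sib1 G v :&: an1 G v = set0.

Definition is_mag : Prop := maximal /\ ancestral.

End MSeparation.

Definition markov_equivalent (V : finType) (G1 G2 : admg V) : Prop :=
  forall A B C : {set V}, m_separated G1 A B C <-> m_separated G2 A B C.

Section ParametrizingSet.
Variables (V : finType) (G : admg V).

Definition barren (W : {set V}) : {set V} :=
  [set w in W | de1 G w :&: W == [set w]].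

Definition dis_in (W S : {set V}) : {set V} := dis (induced G W) S.

(* The empty set is not a head: G_{an(set0)} has no vertex, so no district. *)
Definition is_head (H : {set V}) : bool :=
  (barren H == H) && [exists v in an G H, H \subset dis_in (an G H) [set v]].

Definition heads : {set {set V}} := [set H | is_head H].

Definition tail (H : {set V}) : {set V} :=
  (dis_in (an G H) H :\: H) :|: pa G (dis_in (an G H) H).

Definition param_set : {set {set V}} :=
  [set H :|: A | H in heads, A in powerset (tail H)].

End ParametrizingSet.

(* Main.v *)
(* Call u, v linked in an ancestral set D if they are equal or joined by a
   collider path inside D.  A nonempty set W belongs to S(G) iff its elements are
   pairwise linked in an(W), and a, b are m-connected given C iff they are joined,
   in D = an({a, b} \cup C), by a chain of linked vertices avoiding C.  Hence W is
   in S(G) iff no two of its elements are m-separated by a set containing the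
   rest of W, so S(G) is an invariant of the independence model.

   Conversely, let S(G1) = S(G2), and let a, b be m-separated given C in G1.  If
   an({a, b} \cup C) in G1 is everything, linked pairs of G2 are linked there,
   since both graphs see them through members of S; so a, b are m-separated in
   G2.  Otherwise some sink X of G1 lies outside that set.  As X is a sink, the
   members of S containing X are closed under union.  In a MAG this property of S
   alone implies that deleting X preserves all m-connections between the
   remaining vertices: a route through X can be diverted through a last child of
   X.  So X can be deleted from both graphs, and one concludes by induction. *)
Require Import Defs.
From mathcomp Require Import all_boot.

Set Implicit Arguments.
Unset Strict Implicit.
Unset Printing Implicit Defensive.

(** * Ancestors and the parametrizing set *)

Section Ancestors.
Variables (V : finType) (G : admg V).

Lemma dir_closed_walk (x : V) (p : seq V) :
  path (dir G) x p -> last x p = x -> p = [::].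
Proof.
case/lastP: p => [//|s y] pth; rewrite last_rcons => yx; rewrite yx in pth.
by have := @dir_acyclic V G (x :: s) pth.
Qed.

Lemma connect_dir_anti (x y : V) :
  connect (dir G) x y -> connect (dir G) y x -> x = y.
Proof.
move=> /connectP[p pp ->] /connectP[q qq xq].
have := @dir_closed_walk x (p ++ q).
by rewrite cat_path last_cat pp qq -xq => /(_ isT erefl); case: p {pp qq xq}.
Qed.

Lemma dir_connectF (x y : V) : dir G x y -> connect (dir G) y x -> False.
Proof.
move=> xy /connectP[p pp xp].
by have := @dir_closed_walk x (y :: p); rewrite /= xy pp -xp => /(_ isT erefl).
Qed.

Lemma dir_neq (x y : V) : dir G x y -> x != y.
Proof. by move=> xy; apply/eqP=> e; apply: (dir_connectF xy); rewrite e. Qed.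

Lemma anP (W : {set V}) (x : V) :
  reflect (exists2 w, w \in W & connect (dir G) x w) (x \in an G W).
Proof.
by apply: (iffP bigcupP) => -[w wW]; rewrite ?inE => xw; exists w; rewrite ?inE.
Qed.

Lemma sub_an (W : {set V}) : W \subset an G W.
Proof. by apply/subsetP=> x xW; apply/anP; exists x. Qed.

Lemma an_connect (W : {set V}) (x y : V) :
  connect (dir G) x y -> y \in an G W -> x \in an G W.
Proof.
by move=> xy /anP[w wW yw]; apply/anP; exists w => //; apply: connect_trans yw.
Qed.

Lemma an_dir (W : {set V}) (x y : V) :
  dir G x y -> y \in an G W -> x \in an G W.
Proof. by move=> /connect1; apply: an_connect. Qed.

Lemma an_sub_an (W W' : {set V}) : W \subset an G W' -> an G W \subset an G W'.
Proof.
move=> /subsetP s; apply/subsetP=> x /anP[w /s wW xw]; exact: an_connect wW.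
Qed.

Lemma anS (W W' : {set V}) : W \subset W' -> an G W \subset an G W'.
Proof. by move=> s; apply/an_sub_an/(subset_trans s)/sub_an. Qed.

Lemma an1_proper (x y : V) : dir G x y -> #|an1 G x| < #|an1 G y|.
Proof.
move=> xy; apply: proper_card; apply/properP; split.
  by apply/subsetP=> z; rewrite !inE => zx; apply: connect_trans zx (connect1 xy).
by exists y; rewrite !inE // ; apply/negP; apply: dir_connectF.
Qed.

(** The number of ancestors strictly increases along a directed edge, so a vertex of [P] with the
    most ancestors has no child in [P]. *)
Lemma maximal_descendant (P : pred V) (x : V) : P x ->
  exists2 y, P y & forall z, dir G y z -> ~~ P z.
Proof.
move=> Px; case: (arg_maxnP (fun y => #|an1 G y|) Px) => y Py ymax.
exists y => // z yz; apply/negP=> /ymax; rewrite /= leqNgt.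
by rewrite (an1_proper yz).
Qed.

Lemma barrenP (W : {set V}) (w : V) :
  reflect (w \in W /\ forall v, v \in W -> connect (dir G) w v -> v = w)
          (w \in barren G W).
Proof.
rewrite inE; apply: (iffP andP) => -[wW].
  move=> /eqP e; split=> // v vW wv.
  by apply/set1P; rewrite -e !inE wv.
move=> h; split=> //; apply/eqP/setP=> v; rewrite !inE.
apply/andP/eqP => [[wv vW]|->]; first exact: h.
by rewrite connect0.
Qed.

Lemma barren_sub (W : {set V}) : barren G W \subset W.
Proof. by apply/subsetP=> x; rewrite inE => /andP[]. Qed.

Lemma barren_above (W : {set V}) (w : V) : w \in W ->
  exists2 h, h \in barren G W & connect (dir G) w h.
Proof.
move=> wW; pose P := [pred y | (y \in W) && connect (dir G) w y].
have Pw : P w by rewrite /P /= wW connect0.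
case: (arg_maxnP (fun y => #|an1 G y|) Pw) => h /= /andP[hW wh] hmax.
exists h => //; apply/barrenP; split=> // v vW hv.
apply: connect_dir_anti => //; have := hmax v.
rewrite /P /= vW (connect_trans wh hv) => /(_ isT) le.
have sub : an1 G h \subset an1 G v.
  by apply/subsetP=> z; rewrite !inE => zh; apply: connect_trans zh hv.
have /setP/(_ v) : an1 G h = an1 G v by apply/eqP; rewrite eqEcard sub.
by rewrite !inE connect0.
Qed.

Lemma an_barren (W : {set V}) : an G (barren G W) = an G W.
Proof.
apply/eqP; rewrite eqEsubset anS ?barren_sub //=; apply: an_sub_an.
by apply/subsetP=> w /barren_above[h hB wh]; apply/anP; exists h.
Qed.

End Ancestors.

(** * Extended districts and membership in [param_set] *)

Section ExtendedDistricts.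
Variables (V : finType) (G : admg V).

(* The bidirected component of [x] in [G_D] together with its parents.  For
   ancestral [D], two vertices of [D] lie in a common extended district of [G_D]
   iff they are equal or joined by a collider path in [G_D]. *)
Definition ext (D : {set V}) (x : V) : {set V} :=
  [set u | [exists y, connect (induced_bidir G D) x y && ((u == y) || dir G u y)]].

Definition linked (D : {set V}) : rel V :=
  [rel u v | [exists x in D, (u \in ext D x) && (v \in ext D x)]].

Lemma extP (D : {set V}) (x u : V) :
  reflect (exists2 y, connect (induced_bidir G D) x y & u = y \/ dir G u y)
          (u \in ext D x).
Proof.
rewrite inE; apply: (iffP existsP).
  by move=> [y /andP[xy /orP[/eqP|] h]]; exists y; auto.
by move=> [y xy h]; exists y; rewrite xy; case: h => ->; rewrite ?eqxx ?orbT.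
Qed.

Lemma linkedP (D : {set V}) (u v : V) :
  reflect (exists x, [/\ x \in D, u \in ext D x & v \in ext D x]) (linked D u v).
Proof.
apply: (iffP existsP); first by move=> [x /and3P[]]; exists x.
by move=> [x [h1 h2 h3]]; exists x; rewrite h1 h2.
Qed.

Lemma linked_sym (D : {set V}) (u v : V) : linked D u v -> linked D v u.
Proof. by move=> /linkedP[x [? ? ?]]; apply/linkedP; exists x. Qed.

Lemma bi_sym (D : {set V}) : connect_sym (induced_bidir G D).
Proof. exact/sym_connect_sym/induced_bidir_sym. Qed.

Lemma bi_in (D : {set V}) (x y : V) :
  connect (induced_bidir G D) x y -> x \in D -> y \in D.
Proof.
move=> /connectP[p + ->]; elim: p x => [//|z p IH] x /= /andP[/and3P[_ zD _] pp] _.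
exact: IH.
Qed.

Lemma ext_connect (D : {set V}) (x y : V) :
  connect (induced_bidir G D) x y -> ext D x = ext D y.
Proof.
move=> xy; apply/setP=> u; apply/extP/extP => -[z xz h]; exists z => //.
  by apply: connect_trans xz; rewrite bi_sym.
exact: connect_trans xz.
Qed.

Lemma ext_self (D : {set V}) (x : V) : x \in ext D x.
Proof. by apply/extP; exists x; auto. Qed.

Lemma ext_dir (D : {set V}) (x u : V) : dir G u x -> u \in ext D x.
Proof. by move=> h; apply/extP; exists x; auto. Qed.

Lemma ext_bidir (D : {set V}) (x u : V) :
  x \in D -> u \in D -> bidir G u x -> u \in ext D x.
Proof.
move=> xD uD h; apply/extP; exists u; last by auto.
by apply: connect1; rewrite /induced_bidir /= xD uD bidir_sym.
Qed.

Lemma linked_edge (D : {set V}) (x y : V) :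
  x \in D -> y \in D -> adjacent G x y -> linked D x y.
Proof.
move=> xD yD /or3P[] h; apply/linkedP.
- by exists y; rewrite ext_self ext_dir.
- by exists x; rewrite ext_self ext_dir.
by exists y; rewrite ext_self ext_bidir.
Qed.

Lemma mem_dis_in (D W : {set V}) (y : V) :
  reflect (exists2 x, x \in W & connect (induced_bidir G D) x y)
          (y \in dis_in G D W).
Proof.
by apply: (iffP bigcupP) => -[x xW]; rewrite ?inE => h; exists x; rewrite ?inE.
Qed.

(** Were [w] a parent of some [y] in the component, then [y], lying in an(W), would have a
    descendant in [W]; it would be a proper descendant of [w], contrary to barrenness. *)
Lemma ext_barren (W : {set V}) (x w : V) :
  x \in an G W -> w \in barren G W -> w \in ext (an G W) x ->
  connect (induced_bidir G (an G W)) x w.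
Proof.
move=> xW /barrenP[wW wmax] /extP[y xy [->//|wy]].
have /anP[v vW yv] := bi_in xy xW.
have e := wmax v vW (connect_trans (connect1 wy) yv).
by case: (dir_connectF wy); rewrite -e.
Qed.

(** A head with its whole tail is an extended district of the graph on an(H), and adding part of the
    tail leaves the ancestors unchanged. Conversely, the barren part of [W] is a head and the rest
    of [W] falls in its tail. *)
Lemma param_setP (W : {set V}) :
  reflect (exists2 x, x \in an G W & W \subset ext (an G W) x)
          (W \in param_set G).
Proof.
apply: (iffP imset2P) => [[H A]|[x xW sW]].
  rewrite inE powersetE => /andP[/eqP bH /existsP[v /andP[vH Hv]]] At ->.
  have disan : dis_in G (an G H) H \subset an G H.
    apply/subsetP=> y /mem_dis_in[h hH /bi_in]; apply.
    by rewrite (subsetP (sub_an _ _)).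
  have tan : tail G H \subset an G H.
    rewrite subUset (subset_trans (subsetDl _ _) disan) /=.
    apply/subsetP=> y /bigcupP[z /(subsetP disan) zH]; rewrite inE => yz.
    exact: an_dir zH.
  have anE : an G (H :|: A) = an G H.
    apply/eqP; rewrite eqEsubset [X in _ && X]anS ?subsetUl // andbT.
    by apply: an_sub_an; rewrite subUset sub_an (subset_trans At tan).
  have dv y : y \in dis_in G (an G H) H -> connect (induced_bidir G (an G H)) v y.
    move=> /mem_dis_in[h hH hy]; move/subsetP/(_ h hH)/mem_dis_in: Hv => [v' /set1P-> vh].
    exact: connect_trans hy.
  exists v; rewrite anE //; rewrite subUset; apply/andP; split; apply/subsetP=> y.
    move=> yH; apply/extP; exists y; last by left.
    by apply: dv; apply/mem_dis_in; exists y.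
  move=> /(subsetP At)/setUP[/setDP[/dv vy _]|/bigcupP[z /dv vz]].
    by apply/extP; exists y; auto.
  by rewrite inE => yz; apply/extP; exists z; auto.
pose H := barren G W.
have anH : an G H = an G W := an_barren G W.
have Hx h : h \in H -> connect (induced_bidir G (an G W)) x h.
  move=> hH; apply: ext_barren => //; apply: (subsetP sW).
  by apply: (subsetP (barren_sub G W)).
have [h0 h0H] : exists h, h \in H.
  by move: xW; rewrite -anH => /anP[h]; exists h.
have disx y : connect (induced_bidir G (an G W)) x y -> y \in dis_in G (an G H) H.
  move=> xy; apply/mem_dis_in; exists h0 => //; rewrite anH.
  by apply: connect_trans xy; rewrite bi_sym; apply: Hx.
exists H (W :\: H); last first.
  apply/setP=> y; rewrite in_setU in_setD.
  by case: (boolP (y \in H)) => // /(subsetP (barren_sub _ _)) ->.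
  rewrite powersetE; apply/subsetP=> w /setDP[/(subsetP sW)/extP[y xy wy] wH].
  case: wy => [e|wy]; apply/setUP; [left|right].
    by rewrite inE wH e disx.
  by apply/bigcupP; exists y; rewrite ?inE // disx.
rewrite inE /is_head; apply/andP; split.
  rewrite eqEsubset barren_sub; apply/subsetP=> h hH; apply/barrenP; split=> //.
  move=> v /(subsetP (barren_sub _ _)) vW; move/barrenP: hH => [_]; exact.
apply/existsP; exists x; rewrite anH xW; apply/subsetP=> h hH.
by apply/mem_dis_in; exists x; rewrite ?set11 // Hx.
Qed.

Lemma param_set_linked (W : {set V}) (u v : V) :
  W \in param_set G -> u \in W -> v \in W -> linked (an G W) u v.
Proof.
move=> /param_setP[x xW /subsetP sW] uW vW; apply/linkedP; exists x.
by split=> //; apply: sW.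
Qed.

(** All districts are compared at one barren vertex [h]: by [ext_barren] it lies in the bidirected
    part of each district containing it, so these coincide. *)
Lemma linked_param_set (W : {set V}) (w : V) : w \in W ->
  (forall u v, u \in W -> v \in W -> u != v -> linked (an G W) u v) ->
  W \in param_set G.
Proof.
move=> /(barren_above G)[h hB _] lk; have hW := subsetP (barren_sub G W) _ hB.
apply/param_setP; exists h; first by rewrite (subsetP (sub_an _ _)).
apply/subsetP=> u uW; have [->|uh] := eqVneq u h; first exact: ext_self.
have /linkedP[x [xW ux hx]] := lk u h uW hW uh.
by rewrite -(ext_connect (ext_barren xW hB hx)).
Qed.

Lemma set1_param (x : V) : [set x] \in param_set G.
Proof.
apply: (@linked_param_set _ x) => [|u v /set1P-> /set1P->]; first exact: set11.
by rewrite eqxx.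
Qed.

End ExtendedDistricts.

(** * m-connection through linked pairs *)

Section Walks.
Variables (V : finType) (G : admg V) (C : {set V}).
Implicit Types (p q r : seq (edge_kind * V)).

(* [t] tells whether the edge preceding [p] has an arrowhead at [x]. *)
Definition open_at (t : bool) (x : V) (p : seq (edge_kind * V)) : bool :=
  if p is (e, _) :: _ then
    if t && arrowhead_at_source e then x \in an G C else x \notin C
  else true.

(** Vertices may repeat, so walks can be extended and rerouted freely; [simple_open_walk] turns the
    result back into a path. *)
Definition open_walk (a b : V) (p : seq (edge_kind * V)) : bool :=
  [&& is_walk G a p, inner_open G C p & last a (unzip2 p) == b].

Lemma open_walk_cons (a b y : V) (e : edge_kind) p :
  open_walk a b ((e, y) :: p) =
  [&& edge G a e y, open_at (arrowhead_at_target e) y p & open_walk y b p].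
Proof.
rewrite /open_walk; have -> : inner_open G C ((e, y) :: p) =
    open_at (arrowhead_at_target e) y p && inner_open G C p.
  by case: p => [|[]].
rewrite /=.
by case: (edge G a e y); case: (open_at _ y p); rewrite ?andbF.
Qed.

Lemma open_walk0 (a : V) : open_walk a a [::].
Proof. by rewrite /open_walk /= eqxx. Qed.

Lemma open_walk_cat (a b x : V) (e : edge_kind) p r :
  open_walk a b (p ++ (e, x) :: r) ->
  open_at (arrowhead_at_target e) x r && open_walk x b r.
Proof.
elim: p a => [|[e2 z] p IH] a; rewrite ?cat0s ?cat_cons open_walk_cons.
  by move=> /andP[].
by move=> /and3P[_ _ /IH].
Qed.

(** Following forward edges from [a], the first vertex left through an arrowhead is a collider,
    hence in an(C), and it descends from [a]. *)
Lemma open_walk_turn (a b x y : V) p r :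
  open_walk a b ((Fwd, y) :: p ++ (Bwd, x) :: r) -> a \in an G C.
Proof.
elim: p a y => [|[e z] p IH] a y; rewrite open_walk_cons => /and3P[/= ay oy wy].
  exact: an_dir oy.
apply: an_dir ay _; case: e oy wy => [_ /IH|//|//]; exact.
Qed.

Lemma simple_open_walk (a b : V) p : open_walk a b p ->
  exists r, [/\ open_walk a b r, uniq (a :: unzip2 r) &
                forall t, open_at t a p -> open_at t a r].
Proof.
elim: p a => [|[e y] p IH] a; first by move=> h; exists [::].
rewrite open_walk_cons => /and3P[ay oy /IH[r [wr ur cr]]].
have war : open_walk a b ((e, y) :: r) by rewrite open_walk_cons ay cr.
have [ar|ar] := boolP (a \in y :: unzip2 r); last first.
  by exists ((e, y) :: r); split=> //=; move: ur => /= ->; rewrite ar.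
have [s1 [e1 [s2 E]]] : exists s1 e1 s2, (e, y) :: r = s1 ++ (e1, a) :: s2.
  have : a \in unzip2 ((e, y) :: r) by [].
  elim: (_ :: _) => [//|[e1 z] s IH']; rewrite inE => /predU1P[->|/IH'[s1 [e2 [s2 ->]]]].
    by exists [::], e1, s.
  by exists ((e1, z) :: s1), e2, s2.
have us2 : uniq (a :: unzip2 s2).
  have : uniq (unzip2 ((e, y) :: r)) by [].
  by rewrite E /unzip2 map_cat cat_uniq => /and3P[].
move: (war); rewrite E => /open_walk_cat/andP[o2 w2].
exists s2; split=> // t; case: s2 {us2 w2} E o2 => [//|[e2 z] s2] E /= o2.
case: t => /=; last exact.
(* Delicate case: the discarded loop leaves [a] forwards and returns by an edge out of [a], while
   the kept walk starts with an arrowhead at [a]. The turn inside the loop puts [a] in an(C). *)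
case: e E ay oy war => /= E ay oy war aC; case: e2 E o2 => /= E; rewrite ?andbT ?andbF //;
  case: e1 E => //= E _;
  by case: s1 E => [//|[e3 z3] s1] [_ _ E]; move: war; rewrite E => /open_walk_turn.
Qed.

Definition connecting (a b : V) : Prop := exists p, m_connecting G C a b p.

Lemma connecting_open (a b : V) : connecting a b <-> exists p, open_walk a b p.
Proof.
split=> [[p /andP[/and3P[wp _ lp] op]]|[p /simple_open_walk[r [/and3P[wr or lr] ur _]]]].
  by exists p; apply/and3P.
by exists r; rewrite /m_connecting /is_path wr ur lr.
Qed.

(** For ancestral [D] this is adjacency, up to loops, in the augmented graph of G_D with [C]
    deleted, the analogue of a moral graph. *)
Definition augmented (D : {set V}) : rel V :=
  [rel u v | [&& u \in D :\: C, v \in D :\: C & linked G D u v]].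

Lemma ext_augmented (D : {set V}) (x u v : V) :
  u \in D :\: C -> v \in D :\: C -> x \in D ->
  u \in ext G D x -> v \in ext G D x -> augmented D u v.
Proof. by move=> uD vD xD ux vx; apply/and3P; split=> //; apply/linkedP; exists x. Qed.

(** * From open walks to chains of linked vertices *)

Section WalkToAugmented.
Variables (W : {set V}) (b : V).
Hypotheses (CW : C \subset W) (bW : b \in an G W) (bC : b \notin C).

(** A directed run out of [x] ends at [b] or at a collider in an(C), both inside an(W). *)
Lemma open_walk_fwd_an (x : V) p : open_walk x b p ->
  (if p is (e, _) :: _ then ~~ arrowhead_at_source e else true) -> x \in an G W.
Proof.
elim: p x => [|[e y] p IH] x; first by rewrite /open_walk /= => /eqP->.
rewrite open_walk_cons => /and3P[xy oy wy]; case: e xy oy => //= xy oy _.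
apply: an_dir xy _; move: (IH _ wy); case: p oy {IH wy} => [|[e2 z] p] /=.
  by move=> _; apply.
case: ifP => [_ yC _|/negbT]; last by move=> ns _; apply.
exact: (subsetP (anS G CW)).
Qed.

Lemma open_walk_next_an (x y : V) (e : edge_kind) p :
  x \in an G W -> open_walk x b ((e, y) :: p) -> y \in an G W.
Proof.
move=> xW; rewrite open_walk_cons => /and3P[xy oy wy].
case: (boolP (arrowhead_at_target e)) => te; last first.
  by case: e te xy {oy} => //= _ /an_dir; apply.
have := open_walk_fwd_an wy; rewrite te in oy.
case: p oy {wy} => [|[e2 z] p] /=; first by move=> _; apply.
case: ifP => [_ yC _|/negbT]; last by move=> ns _; apply.
exact: (subsetP (anS G CW)).
Qed.

(** Invariant: [u] is the start or the latest noncollider met, and [x] is [u] or a vertex reached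
    from it through colliders only. A new collider keeps [u]; a new noncollider is linked to [u] and
    replaces it. *)
Lemma open_walk_augmented (x u : V) p :
  x \in an G W -> u \in an G W :\: C -> u \in ext G (an G W) x ->
  open_walk x b p ->
  (if p is (e, _) :: _ then (x == u) || arrowhead_at_source e else true) ->
  connect (augmented (an G W)) u b.
Proof.
set D := an G W; elim: p x u => [|[e y] p IH] x u xD uD ux.
  move=> /eqP/= xb _; apply/connect1/(ext_augmented (x := b)) => //.
  - by rewrite inE bC.
  - by rewrite -xb.
  exact: ext_self.
move=> w start; have yD := open_walk_next_an xD w.
move: w; rewrite open_walk_cons => /and3P[xy oy wy].
(* [x] or [y] is a centre of an extended district that contains both u and y *)
have [z [zD uz yz]] : exists z, [/\ z \in D, u \in ext G D z & y \in ext G D z].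
  case: e xy start {oy} => /= xy start; first 1 last.
  - by exists x; rewrite ux ext_dir.
  - by exists x; rewrite ux ext_bidir // bidir_sym.
  by exists y; rewrite ext_self yD; move: start; rewrite orbF => /eqP <-; rewrite ext_dir.
have step : y \notin C -> connect (augmented D) u y.
  by move=> yC; apply/connect1/(ext_augmented (x := z)) => //; rewrite inE yC.
have tu : arrowhead_at_target e -> u \in ext G D y.
  case: e xy start {oy} => //= xy start _.
    by move: start; rewrite orbF => /eqP <-; rewrite ext_dir.
  rewrite -(@ext_connect _ _ D x y) //; apply: connect1.
  by rewrite /induced_bidir /= xD yD.
case: p wy oy IH => [|[e2 z2] p] wy /= oy IH.
  by move: wy step => /eqP/= ->; apply.
case: ifP oy => [/andP[te te2] yC|_ yC].
  by apply: (IH y u) => //; [exact: tu|rewrite te2 orbT].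
apply: connect_trans (step yC) _; apply: (IH y y) => //; rewrite ?ext_self ?eqxx //.
by rewrite inE yC.
Qed.

End WalkToAugmented.

(** * From chains of linked vertices to open walks *)

Section AugmentedToWalk.
Variables (a b : V) (D : {set V}).
Hypotheses (DE : D = an G (a |: (b |: C))) (bC : b \notin C).

(** The second alternative is a walk to which an edge with an arrowhead at [x] can be prepended; the
    first records that a detour has already reached [a]. *)
Definition attached (x : V) : Prop :=
  (exists p, open_walk a b p) \/ (exists2 p, open_walk x b p & open_at true x p).

Lemma open_walk_bwd (x : V) p :
  connect (dir G) x a -> x \notin an G C -> open_walk x b p ->
  exists q, open_walk a b q.
Proof.
move=> /connectP[s + aE]; rewrite aE; elim: s x p {aE} => [|z s IH] x p /=.
  by exists p.
move=> /andP[xz pz] xC wp; apply: (IH z ((Bwd, x) :: p)) => //.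
  by apply: contra xC => zC; apply: an_dir zC.
rewrite open_walk_cons /= xz wp andbT.
by case: p {wp} => [//|[e w] p] /=; apply: contra xC; apply/subsetP/sub_an.
Qed.

Lemma open_walk_fwd (x : V) :
  connect (dir G) x b -> x \notin an G C ->
  exists2 p, open_walk x b p & open_at true x p.
Proof.
move=> /connectP[s + bE]; rewrite bE; elim: s x {bE} => [|y s IH] x /=.
  by exists [::]; rewrite ?open_walk0.
move=> /andP[xy ps] xC; have yC : y \notin an G C by apply: contra xC => /an_dir; apply.
have [p wp op] := IH y ps yC; exists ((Fwd, y) :: p).
  by rewrite open_walk_cons /= xy op.
by apply: contra xC; apply/subsetP/sub_an.
Qed.

(** If [x] is in an(C), it may serve as a collider. Otherwise a directed path avoiding [C] leads
    from [x] to [a] or [b]: the former, taken backwards, joins [a] to the given walk; the latter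
    replaces the walk. *)
Lemma attach (x : V) p : x \in D -> open_walk x b p ->
  (if p is (e, _) :: _ then (x \notin C) || arrowhead_at_source e else true) ->
  attached x.
Proof.
move=> xD wp sp; have [xC|xC] := boolP (x \in an G C).
  right; exists p => //; case: p sp {wp} => [//|[e y] p] /=.
  by case: ifP => // _; rewrite orbF.
move: xD; rewrite DE => /anP[w /setU1P[->|/setU1P[->|wC]] xw].
- by left; apply: open_walk_bwd xw xC wp.
- by right; apply: open_walk_fwd.
by case/negP: xC; apply/anP; exists w.
Qed.

Lemma attached_self : attached b.
Proof. by right; exists [::]; rewrite ?open_walk0. Qed.

Lemma attached_bidir (x y : V) : x \in D -> bidir G x y -> attached y -> attached x.
Proof.
move=> xD xy [h|[p wp op]]; first by left.
by apply: (@attach x ((Bid, y) :: p)); rewrite ?open_walk_cons //= ?xy ?op // orbT.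
Qed.

Lemma attached_dir (x y : V) :
  x \in D -> x \notin C -> dir G x y -> attached y -> attached x.
Proof.
move=> xD xC xy [h|[p wp op]]; first by left.
by apply: (@attach x ((Fwd, y) :: p)); rewrite ?open_walk_cons //= ?xy ?op // xC.
Qed.

Lemma attached_rdir (x y : V) :
  x \in D -> y \notin C -> dir G y x -> attached y -> attached x.
Proof.
move=> xD yC xy [h|[p wp op]]; first by left.
apply: (@attach x ((Bwd, y) :: p)); rewrite ?open_walk_cons //= ?orbT // xy wp andbT.
by case: p {wp op} => [//|[]].
Qed.

Lemma attached_connect (x y : V) :
  connect (induced_bidir G D) x y -> attached y -> attached x.
Proof.
move=> /connectP[s + yE]; rewrite yE; elim: s x {yE} => [//|z s IH] x /=.
by move=> /andP[/and3P[xD zD xz] ps] /(IH z ps); apply: attached_bidir.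
Qed.

Lemma attached_augmented (u v : V) : augmented D u v -> attached v -> attached u.
Proof.
move=> /and3P[/setDP[uD uC] /setDP[vD vC]].
move=> /linkedP[x [xD /extP[y xy uy] /extP[z xz vz]]] av.
have az : attached z.
  by case: vz => [<- //|vz]; apply: attached_rdir av; rewrite ?(bi_in xz).
have ay : attached y.
  apply: attached_connect az; apply: connect_trans xz; by rewrite bi_sym.
by case: uy => [-> //|uy]; apply: attached_dir ay.
Qed.

Lemma augmented_open_walk : connect (augmented D) a b -> exists p, open_walk a b p.
Proof.
move=> /connectP[s + bE].
suff h (x : V) : path (augmented D) x s -> last x s = b -> attached x.
  by move=> ps; case: (h a ps (esym bE)) => // -[p]; exists p.
elim: s x {bE} => [|y s IH] x /=; first by move=> _ ->; apply: attached_self.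
by move=> /andP[xy ps] /(IH _ ps); apply: attached_augmented xy.
Qed.

End AugmentedToWalk.

(** The colliders between consecutive noncolliders of an open walk link them, and noncolliders avoid
    [C]. Conversely, the collider path behind each link is opened vertex by vertex with [attach]. *)
Lemma connectingP (a b : V) : a \notin C -> b \notin C ->
  connecting a b <-> connect (augmented (an G (a |: (b |: C)))) a b.
Proof.
move=> aC bC; split=> [/connecting_open[p wp]|ab]; last first.
  by apply/connecting_open; apply: augmented_open_walk ab.
have mem x : x \in a |: (b |: C) -> x \in an G (a |: (b |: C)).
  exact/subsetP/sub_an.
apply: (@open_walk_augmented _ _ _ _ _ a a p) => //.
- by apply/subsetP=> x xC; rewrite !inE xC !orbT.
- by apply: mem; rewrite !inE eqxx orbT.
- by apply: mem; rewrite !inE eqxx.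
- by rewrite inE aC mem // !inE eqxx.
- exact: ext_self.
by case: p wp => [//|[e y] p] _; rewrite eqxx.
Qed.

End Walks.

(** * Removing a vertex *)

Section Subgraphs.
Variables (V : finType) (G G' : admg V).
Hypotheses (dirS : forall x y, dir G x y -> dir G' x y)
           (bidirS : forall x y, bidir G x y -> bidir G' x y).

Lemma connect_dirS (x y : V) : connect (dir G) x y -> connect (dir G') x y.
Proof. by apply: connect_sub => u v /dirS/connect1. Qed.

Lemma an_subgraph (W : {set V}) : an G W \subset an G' W.
Proof. by apply/subsetP=> x /anP[w wW /connect_dirS xw]; apply/anP; exists w. Qed.

Lemma ext_subgraph (D D' : {set V}) (x : V) :
  D \subset D' -> ext G D x \subset ext G' D' x.
Proof.
move=> /subsetP sD; apply/subsetP=> u /extP[y xy uy]; apply/extP; exists y.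
  apply: connect_sub xy => w z /and3P[wD zD wz]; apply: connect1.
  by rewrite /induced_bidir /= !sD ?bidirS.
by case: uy => [|/dirS]; auto.
Qed.

Lemma linked_subgraph (D D' : {set V}) (u v : V) :
  D \subset D' -> linked G D u v -> linked G' D' u v.
Proof.
move=> sD /linkedP[x [xD ux vx]]; have s := subsetP (ext_subgraph x sD).
by apply/linkedP; exists x; rewrite !s // (subsetP sD).
Qed.

End Subgraphs.

(** * Adjacency and links in MAGs *)

Section Mags.
Variables (V : finType) (G : admg V).

Lemma extS (D D' : {set V}) (x : V) : D \subset D' -> ext G D x \subset ext G D' x.
Proof. exact: ext_subgraph. Qed.

Lemma linkedS (D D' : {set V}) (u v : V) :
  D \subset D' -> linked G D u v -> linked G D' u v.
Proof. exact: linked_subgraph. Qed.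

Lemma adjacent_sym (x y : V) : adjacent G x y = adjacent G y x.
Proof. by rewrite /adjacent bidir_sym orbCA. Qed.

Lemma adjacent_neq (x y : V) : adjacent G x y -> x != y.
Proof.
case/or3P=> [/dir_neq //|/dir_neq|]; first by rewrite eq_sym.
by apply: contraTneq => ->; rewrite bidir_irr.
Qed.

Lemma param_set2 (u v : V) : adjacent G u v -> [set u; v] \in param_set G.
Proof.
move=> uv; have s := subsetP (sub_an G [set u; v]).
apply: (@linked_param_set _ _ _ u) => [|x y xW yW xy]; first by rewrite !inE eqxx.
apply: linked_edge; rewrite ?s //.
by move: xW yW xy => /set2P[]-> /set2P[]->; rewrite ?eqxx // adjacent_sym.
Qed.

(** A deleted vertex stays in [V] as an isolated one, so the non-isolated vertices measure what is
    left of the graph. *)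
Definition isolated (x : V) : bool := [forall y, ~~ adjacent G x y].

Lemma isolatedPn (x : V) : reflect (exists y, adjacent G x y) (~~ isolated x).
Proof.
rewrite negb_forall.
by apply: (iffP existsP) => -[y]; rewrite ?negbK => h; exists y; rewrite ?negbK.
Qed.

Lemma isolated_bi (D : {set V}) (x y : V) :
  isolated x -> connect (induced_bidir G D) x y -> y = x.
Proof.
move=> /forallP ix /connectP[[|z p] /= + ->] //.
by move=> /andP[/and3P[_ _ xz] _]; have := ix z; rewrite /adjacent xz !orbT.
Qed.

Lemma isolated_linked (D : {set V}) (x y : V) : isolated x -> linked G D x y -> y = x.
Proof.
move=> ix /linkedP[z [zD /extP[u zu xu] /extP[v zv yv]]].
have ux : u = x.
  by case: xu => // xu; have /forallP/(_ u) := ix; rewrite /adjacent xu.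
have zx : z = x by apply: (@isolated_bi D) => //; rewrite bi_sym -ux.
have vx : v = x by apply: (@isolated_bi D) => //; rewrite -zx.
case: yv => [->//|]; rewrite vx => yx.
by have /forallP/(_ y) := ix; rewrite /adjacent yx orbT.
Qed.

Lemma ancestralF (u v : V) :
  ancestral G -> bidir G u v -> connect (dir G) u v -> False.
Proof. by move=> /(_ v)/setP/(_ u) + uv cuv; rewrite !inE uv cuv. Qed.

(** The absence of inducing paths between nonadjacent vertices; in this form maximality passes
    directly to the graph with a vertex removed. *)
Definition adjacent_linked : Prop :=
  forall u v, u != v -> linked G (an G [set u; v]) u v -> adjacent G u v.

(** A link inside an({u, v}) persists when any [C] is added to {u, v}, so no [C] separates the
    pair. *)
Lemma maximal_adjacent_linked : maximal G -> adjacent_linked.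
Proof.
move=> mG u v uv lk; apply: contraT => /(mG u v uv)[C [_ _]].
rewrite !disjoints1 => uC vC /(_ u v (set11 _) (set11 _)) nc; case: nc.
apply/(connectingP _ uC vC)/connect1.
have s : [set u; v] \subset u |: (v |: C).
  by apply/subsetP=> x; rewrite !inE => /orP[]->; rewrite ?orbT.
have inan x : x \in [set u; v] -> x \in an G (u |: (v |: C)).
  by move=> /(subsetP s); apply/subsetP/sub_an.
apply/and3P; split; last exact: linkedS (anS G s) lk.
  by rewrite inE uC inan // !inE eqxx.
by rewrite inE vC inan // !inE eqxx orbT.
Qed.

Lemma param_adjacent (W : {set V}) (u v : V) : adjacent_linked ->
  W \in param_set G -> u \in W -> v \in W -> u != v -> W \subset an G [set u; v] ->
  adjacent G u v.
Proof.
move=> mG WS uW vW uv sW; apply: mG => //.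
by apply: linkedS (param_set_linked WS uW vW); apply: an_sub_an.
Qed.

End Mags.

(** * Bypassing a vertex [X] at which S is closed under union *)

Section Removal.
Variables (V : finType) (G : admg V) (X : V).

(* Holds for every sink; unlike being a sink, it depends only on the parametrizing set. *)
Definition union_closed_at : Prop := forall W W' : {set V},
  W \in param_set G -> W' \in param_set G -> X \in W -> X \in W' ->
  W :|: W' \in param_set G.

(** A sink is nobody's parent, so an extended district containing [X] is the one centred at [X]; two
    members of S containing [X] thus fit into a common one. *)
Lemma sink_union_closed : (forall y, ~~ dir G X y) -> union_closed_at.
Proof.
move=> sink; have ext_sink (W : {set V}) :
    W \in param_set G -> X \in W -> W \subset ext G (an G W) X.
  move=> /param_setP[x xW sW] /(subsetP sW)/extP[y xy].
  by case=> [Xy|]; [rewrite Xy -(ext_connect xy)|rewrite (negPf (sink y))].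
move=> W W' WS WS' XW XW'; apply/param_setP; exists X.
  by apply: (subsetP (sub_an _ _)); rewrite inE XW.
rewrite subUset; apply/andP; split; [apply: subset_trans (ext_sink _ WS XW) _|
  apply: subset_trans (ext_sink _ WS' XW') _]; apply: extS; apply: anS.
  exact: subsetUl.
exact: subsetUr.
Qed.

Hypotheses (mG : adjacent_linked G) (aG : ancestral G) (ucX : union_closed_at).

Let G' := induced G [set~ X].

Lemma dir_remove (x y : V) : dir G' x y = [&& x != X, y != X & dir G x y].
Proof. by rewrite /= /induced_dir /= !inE. Qed.

Lemma bidir_remove (x y : V) : bidir G' x y = [&& x != X, y != X & bidir G x y].
Proof. by rewrite /= /induced_bidir /= !inE. Qed.

Lemma dir_removeS (x y : V) : dir G' x y -> dir G x y.
Proof. by rewrite dir_remove => /and3P[]. Qed.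

Lemma bidir_removeS (x y : V) : bidir G' x y -> bidir G x y.
Proof. by rewrite bidir_remove => /and3P[]. Qed.

Lemma adjacent_remove (x y : V) :
  adjacent G' x y = [&& x != X, y != X & adjacent G x y].
Proof.
rewrite /adjacent !dir_remove bidir_remove.
by case: (x != X); case: (y != X); rewrite ?andbF.
Qed.

Lemma isolated_remove : isolated G' X.
Proof. by apply/forallP=> y; rewrite adjacent_remove eqxx. Qed.

Lemma param_add (T : {set V}) (z : V) :
  T \in param_set G -> X \in T -> adjacent G X z -> z |: T \in param_set G.
Proof.
move=> TS XT /param_set2 XzS; have -> : z |: T = T :|: [set X; z].
  apply/setP=> y; rewrite !inE.
  by have [->|] := eqVneq y X; rewrite ?XT ?orbT //= orbC.
by apply: ucX => //; rewrite !inE eqxx.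
Qed.

Lemma dir_adjacent (x y : V) : dir G x y -> adjacent G x y.
Proof. by rewrite /adjacent => ->. Qed.

(** Union closure puts {u, X, w} in S. As [X] is a parent of [w], this set lies in an({u, w}), and
    maximality applies. *)
Lemma adjacent_bypass (u w : V) :
  adjacent G u X -> dir G X w -> u != w -> adjacent G u w.
Proof.
move=> uX Xw uw.
have s : [set u; w] \subset an G [set u; w] := sub_an _ _.
apply: (@param_adjacent _ _ (w |: [set u; X])) => //.
- apply: param_add; rewrite ?dir_adjacent ?param_set2 //.
  by rewrite !inE eqxx orbT.
- by rewrite !inE eqxx orbT.
- by rewrite !inE eqxx.
have wA : w \in an G [set u; w] by rewrite (subsetP s) // !inE eqxx orbT.
apply/subsetP=> y; rewrite !inE => /or3P[]/eqP-> //.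
  by rewrite (subsetP s) // !inE eqxx.
exact: an_dir Xw wA.
Qed.

Lemma dir_bypass (u w : V) : dir G u X -> dir G X w -> dir G u w.
Proof.
move=> uX Xw; have uw : connect (dir G) u w := connect_trans (connect1 uX) (connect1 Xw).
have neq : u != w.
  by apply/eqP=> e; rewrite -e in Xw; case: (dir_connectF uX (connect1 Xw)).
case/or3P: (adjacent_bypass (dir_adjacent uX) Xw neq) => // [wu|].
  by case: (dir_connectF wu uw).
by move=> b; case: (ancestralF aG b uw).
Qed.

Lemma connect_remove (u c : V) : u != X -> c != X ->
  connect (dir G) u c -> connect (dir G') u c.
Proof.
move=> uX cX /connectP[p pp cE].
(* A path starting at [X] is handled through the parents of [X], which skip it by [dir_bypass]. *)
suff h (y : V) : path (dir G) y p -> last y p = c ->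
    (y != X -> connect (dir G') y c) /\
    (y = X -> forall w, dir G w X -> connect (dir G') w c).
  by case: (h u pp (esym cE)) => + _; apply.
elim: p y {pp cE} => [|z p IH] y /=.
  by move=> _ ->; split=> [//|e]; rewrite e eqxx in cX.
move=> /andP[yz pz] /(IH z pz)[IH1 IH2]; split=> [yX|yX w wX].
  have [zX|zX] := eqVneq z X; first by apply: IH2 => //; rewrite -zX.
  by apply: connect_trans (IH1 zX); apply: connect1; rewrite dir_remove yX zX.
rewrite yX in yz; have zX : z != X by rewrite eq_sym (dir_neq yz).
apply: connect_trans (IH1 zX); apply: connect1.
by rewrite dir_remove (dir_neq wX) zX (dir_bypass wX).
Qed.

Lemma an_remove (B : {set V}) : X \notin B -> an G' B = an G B :\ X.
Proof.
move=> XB; have nX w : w \in B -> w != X by apply: contraTneq => ->.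
apply/setP=> x; rewrite in_setD1; apply/idP/andP => [xB|[xX /anP[w wB xw]]].
  split; last by apply: (subsetP (an_subgraph dir_removeS _)).
  move/anP: xB => [w wB /connectP[[|z p] /= + e]]; first by rewrite -e nX.
  by rewrite [induced_dir _ _ _ _]dir_remove => /andP[/andP[]].
by apply/anP; exists w => //; apply: connect_remove => //; apply: nX.
Qed.

Section Ancestral.
Variable D : {set V}.
Hypotheses (Dan : forall x y, dir G x y -> y \in D -> x \in D)
           (Dch : X \in D -> exists2 z, z \in D & dir G X z).

(** * Diverting links through [X] to its last child *)

Section LastChild.
Variable Z : V.
Hypotheses (ZD : Z \in D) (XZ : dir G X Z)
           (Zmax : forall z, z \in D -> dir G X z -> ~~ dir G Z z).

Let ZX : Z != X. Proof. by rewrite eq_sym (dir_neq XZ). Qed.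

Let ZD' : Z \in D :\ X. Proof. by rewrite !inE ZX. Qed.

(* In the second case [T] is the vertex set of a collider path from [X] to [y],
   all of whose vertices are parents of [Z]. *)
Definition absorbed (y : V) : Prop :=
  connect (induced_bidir G' (D :\ X)) Z y \/
  exists T : {set V}, [/\ X \in T, y \in T, T \subset pa1 G Z & T \subset ext G T y].

Lemma absorbed_self : absorbed X.
Proof.
right; exists [set X]; split; rewrite ?set11 // sub1set; last exact: ext_self.
by rewrite inE.
Qed.

(** As on a discriminating path: [T] with [u] is a member of S containing [X], and union with {X, Z}
    adds [Z]. Since [T] consists of parents of [Z], everything lies in an({u, Z}), so [u] and [Z]
    are adjacent; Z -> u would violate acyclicity or ancestrality. *)
Lemma collider_path_child (T : {set V}) (t u : V) :
  X \in T -> t \in T -> T \subset pa1 G Z -> T \subset ext G T t ->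
  bidir G u t \/ dir G u t -> dir G u Z \/ bidir G u Z.
Proof.
move=> XT tT /subsetP TZ Text ut.
have tZ : dir G t Z by have := TZ t tT; rewrite inE.
have uA : u \in an G (u |: T) by rewrite (subsetP (sub_an _ _)) // !inE eqxx.
have TA : T \subset an G (u |: T) := subset_trans (subsetUr _ _) (sub_an _ _).
have tA := subsetP TA _ tT.
have TS : u |: T \in param_set G.
  apply/param_setP; exists t => //.
  rewrite subUset sub1set (subset_trans Text) ?extS // andbT.
  by case: ut => ut; [apply: ext_bidir|apply: ext_dir].
have uZ : u != Z.
  apply/eqP=> e; rewrite e in ut; case: ut => [ut|ut].
    by apply: (ancestralF aG _ (connect1 tZ)); rewrite bidir_sym.
  by case: (dir_connectF ut (connect1 tZ)).
have ZA : Z \in an G [set u; Z] by rewrite (subsetP (sub_an _ _)) // !inE eqxx orbT.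
have : adjacent G u Z.
  apply: (@param_adjacent _ _ (Z |: (u |: T))) => //.
  - by apply: param_add; rewrite ?dir_adjacent // inE XT orbT.
  - by rewrite !inE eqxx orbT.
  - by rewrite !inE eqxx.
  rewrite !subUset !sub1set ZA (subsetP (sub_an _ _)) ?inE ?eqxx //=.
  by apply/subsetP=> y /TZ; rewrite inE => /an_dir; apply.
case/or3P; [by left| |by right] => Zu.
have tu := connect_trans (connect1 tZ) (connect1 Zu).
case: ut => ut; last by case: (dir_connectF ut tu).
by case: (ancestralF aG _ tu); rewrite bidir_sym.
Qed.

(** If [y] lies on a collider path of parents of [Z], then [u] either extends that path or joins the
    bidirected component of [Z]. *)
Lemma absorbed_bidir (y u : V) : u \in D -> bidir G u y -> absorbed y -> absorbed u.
Proof.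
move=> uD uy; have [->|uX] := eqVneq u X; first by move=> _; exact: absorbed_self.
have uD' : u \in D :\ X by rewrite !inE uX.
move=> [Zy|[T [XT yT TZ Text]]].
  left; apply: (connect_trans Zy); apply: connect1; have := bi_in Zy ZD'.
  rewrite !inE => /andP[yX yD]; rewrite /induced_bidir /= !inE yX yD uX uD.
  by rewrite /= /induced_bidir /= !inE yX uX bidir_sym.
have [uZ|uZ] := collider_path_child XT yT TZ Text (or_introl uy).
  right; exists (u |: T); rewrite !inE eqxx XT orbT; split=> //.
    by rewrite subUset sub1set inE uZ.
  rewrite subUset sub1set ext_self /=.
  rewrite -(@ext_connect _ _ (u |: T) y u).
    by apply: subset_trans Text (extS _ _ (subsetUr _ _)).
  by apply: connect1; rewrite /induced_bidir /= !inE eqxx yT orbT bidir_sym.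
left; apply: connect1; rewrite /induced_bidir /= !inE ZX ZD uX uD.
by rewrite /= /induced_bidir /= !inE ZX uX bidir_sym.
Qed.

Lemma absorbed_connect (x y : V) :
  connect (induced_bidir G D) x y -> absorbed x -> absorbed y.
Proof.
move=> /connectP[p + ->]; elim: p x => [//|z p IH] x /= /andP[/and3P[_ zD xz] pp] ax.
by apply: IH pp _; apply: absorbed_bidir ax => //; rewrite bidir_sym.
Qed.

(** This is where [Z] must be last: [y] and [Z] are adjacent by [adjacent_bypass], and [Zmax] rules
    out Z -> y. *)
Lemma absorbed_child (y : V) : y \in D -> dir G X y -> absorbed y.
Proof.
move=> yD Xy; have [->|yZ] := eqVneq y Z; first by left.
have yX : y != X by rewrite eq_sym (dir_neq Xy).
have yadjX : adjacent G y X by rewrite adjacent_sym dir_adjacent.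
case/or3P: (adjacent_bypass yadjX XZ yZ) => yZ'.
- right; exists [set X; y]; split.
  + exact: set21.
  + exact: set22.
  + by rewrite subUset !sub1set !inE XZ.
  by rewrite subUset !sub1set ext_self ext_dir.
- by case/negP: (Zmax yD Xy).
left; apply: connect1; rewrite /induced_bidir /= !inE ZX ZD yX yD.
by rewrite /= /induced_bidir /= !inE ZX yX bidir_sym.
Qed.

Lemma absorbed_ext (y u : V) : u \in D -> u != X -> absorbed y ->
  u = y \/ dir G u y -> u \in ext G' (D :\ X) Z.
Proof.
move=> uD uX ay uy; have uD' : u \in D :\ X by rewrite !inE uX.
have uZ_ext : dir G u Z -> u \in ext G' (D :\ X) Z.
  by move=> uZ; apply: ext_dir; rewrite dir_remove uX ZX.
case: ay => [Zy|[T [XT yT TZ Text]]].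
  apply/extP; exists y => //; case: uy => [|uy]; [by left|right].
  by have := bi_in Zy ZD'; rewrite !inE dir_remove uX uy => /andP[-> _].
case: uy => [e|uy].
  by apply: uZ_ext; have := subsetP TZ y yT; rewrite inE e.
case: (collider_path_child XT yT TZ Text (or_intror uy)) => // uZ.
by apply: ext_bidir; rewrite // bidir_remove uX ZX.
Qed.

(** Absorption starts at [X] or at a child of [X] in the component, and spreads along bidirected
    edges to [u] or a child of [u]. *)
Lemma linked_last_child (u : V) : u \in D -> u != X -> linked G D u X ->
  u \in ext G' (D :\ X) Z.
Proof.
move=> uD uX /linkedP[x [xD /extP[y xy uy] /extP[z xz Xz]]].
apply: absorbed_ext uy => //; have zD := bi_in xz xD.
apply: (@absorbed_connect z); first by apply: connect_trans xy; rewrite bi_sym.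
case: Xz => [<-|Xz]; [exact: absorbed_self|exact: absorbed_child].
Qed.

End LastChild.

Lemma last_child : X \in D -> exists Z, [/\ Z \in D, dir G X Z &
  forall z, z \in D -> dir G X z -> ~~ dir G Z z].
Proof.
move=> /Dch[z zD Xz].
have [|Z /andP[ZD XZ] Zmax] :=
    @maximal_descendant _ G [pred z | (z \in D) && dir G X z] z.
  by rewrite /= zD.
exists Z; split=> // w wD Xw; apply/negP=> /Zmax.
by rewrite /= wD Xw.
Qed.

Lemma linked_through (u v : V) : u \in D -> v \in D -> u != X -> v != X ->
  linked G D u X -> linked G D X v -> linked G' (D :\ X) u v.
Proof.
move=> uD vD uX vX luX lXv.
have XD : X \in D.
  by case/linkedP: luX => x [xD _ /extP[y /bi_in/(_ xD) yD [->|/Dan]]] //; apply.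
have [Z [ZD XZ Zmax]] := last_child XD.
apply/linkedP; exists Z; split.
- by rewrite !inE ZD eq_sym (dir_neq XZ).
- exact: linked_last_child.
by apply: linked_last_child => //; apply: linked_sym.
Qed.

Lemma bi_remove (x y : V) : connect (induced_bidir G D) x y ->
  ~~ connect (induced_bidir G D) x X -> connect (induced_bidir G' (D :\ X)) x y.
Proof.
move=> /connectP[p + ->]; elim: p x => [//|z p IH] x /= /andP[xz pp] xX.
have zX : ~~ connect (induced_bidir G D) z X.
  by apply: contra xX; apply: connect_trans (connect1 xz).
apply: connect_trans (IH z pp zX); apply: connect1; move: xz => /and3P[xD zD xz].
have nX w : ~~ connect (induced_bidir G D) w X -> w != X by apply: contraNneq => ->.
by rewrite /induced_bidir /= !inE xD zD /= /induced_bidir /= !inE !nX.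
Qed.

(** A bidirected component avoiding [X] survives the deletion; otherwise both vertices are linked to
    [X] and [linked_through] applies. *)
Lemma linked_remove (u v : V) : u \in D -> v \in D -> u != X -> v != X ->
  linked G D u v -> linked G' (D :\ X) u v.
Proof.
move=> uD vD uX vX /linkedP[x [xD ux vx]].
have [xX|xX] := boolP (connect (induced_bidir G D) x X).
  have Xx : X \in ext G D x by apply/extP; exists X; auto.
  by apply: linked_through => //; apply/linkedP; exists x.
have main w : w != X -> w \in ext G D x -> w \in ext G' (D :\ X) x.
  move=> wX /extP[y xy wy]; apply/extP; exists y; first exact: bi_remove.
  case: wy => [|wy]; [by left|right]; rewrite dir_remove wX wy andbT /=.
  by apply: contraNneq xX => <-.
apply/linkedP; exists x; split; try exact: main.
by rewrite !inE xD andbT; apply: contraNneq xX => ->.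
Qed.

Lemma augmented_remove (C : {set V}) (a b : V) : a != X -> b != X ->
  connect (augmented G C D) a b -> connect (augmented G' C (D :\ X)) a b.
Proof.
move=> aX bX /connectP[p pp bE].
(* When the chain visits [X], its predecessor is linked to its successor by [linked_through]. *)
suff h (y : V) : path (augmented G C D) y p -> last y p = b ->
    (y != X -> connect (augmented G' C (D :\ X)) y b) /\
    (y = X -> forall w, w != X -> augmented G C D w X ->
       connect (augmented G' C (D :\ X)) w b).
  by case: (h a pp (esym bE)) => + _; apply.
elim: p y {pp bE} => [|z p IH] y /=.
  by move=> _ ->; split=> [//|e]; rewrite e eqxx in bX.
move=> /andP[yz pz] /(IH z pz)[IH1 IH2]; split=> [yX|yX w wX wXl].
  have [zX|zX] := eqVneq z X; first by apply: IH2 => //; rewrite -zX.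
  apply: connect_trans (IH1 zX); apply: connect1.
  move/and3P: yz => [/setDP[yD yC] /setDP[zD zC] lyz].
  by apply/and3P; rewrite !inE yC yX zX zC yD zD; split=> //; apply: linked_remove.
rewrite yX in yz; have [zX|zX] := eqVneq z X; first exact: IH2.
apply: connect_trans (IH1 zX); apply: connect1.
move/and3P: yz => [_ /setDP[zD zC] lXz]; move/and3P: wXl => [/setDP[wD wC] _ lwX].
by apply/and3P; rewrite !inE wC wX zX zC wD zD; split=> //; apply: linked_through.
Qed.

End Ancestral.

Lemma an_child (B : {set V}) : X \notin B -> X \in an G B ->
  exists2 z, z \in an G B & dir G X z.
Proof.
move=> XB /anP[w wB /connectP[[|z p] /= pp wE]]; first by rewrite -wE wB in XB.
case/andP: pp => Xz pz; exists z => //; apply/anP; exists w => //.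
by apply/connectP; exists p.
Qed.

Lemma connect_augmented_remove (C : {set V}) (a b : V) : X \notin a |: (b |: C) ->
  connect (augmented G C (an G (a |: (b |: C)))) a b =
  connect (augmented G' C (an G' (a |: (b |: C)))) a b.
Proof.
set B := a |: _ => XB; rewrite an_remove //; apply/idP/idP.
  apply: augmented_remove.
  - by move=> x y; apply: an_dir.
  - exact: an_child.
  - by apply: contraNneq XB => <-; rewrite !inE eqxx.
  - by apply: contraNneq XB => <-; rewrite !inE eqxx orbT.
apply: connect_sub => u v /and3P[/setDP[/setD1P[_ uD] uC] /setDP[/setD1P[_ vD] vC] uv].
apply/connect1/and3P; rewrite !inE uD vD uC vC; split=> //.
by apply: linked_subgraph uv; [exact: dir_removeS|exact: bidir_removeS|exact: subsetDl].
Qed.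

Lemma adjacent_linked_remove : adjacent_linked G'.
Proof.
move=> u v uv lk; have [uX|uX] := eqVneq u X.
  rewrite uX in lk uv; case/eqP: uv.
  by rewrite (isolated_linked isolated_remove lk).
have [vX|vX] := eqVneq v X.
  rewrite vX in lk uv; case/eqP: uv.
  by rewrite (isolated_linked isolated_remove (linked_sym lk)).
rewrite adjacent_remove uX vX; apply: mG => //.
apply: linked_subgraph lk; first exact: dir_removeS.
  exact: bidir_removeS.
exact: an_subgraph dir_removeS _.
Qed.

Lemma ancestral_remove : ancestral G'.
Proof.
move=> v; apply/setP=> w; rewrite !inE; apply/negP => /andP[/bidir_removeS wv cwv].
exact: ancestralF aG wv (connect_dirS dir_removeS cwv).
Qed.

(** The right-hand side depends on [G] only through S(G), so equality of parametrizing sets survives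
    deleting [X] from both graphs. *)
Lemma param_set_remove (W : {set V}) :
  (W \in param_set G') = if X \in W then W == [set X] else W \in param_set G.
Proof.
have lk := @linked_subgraph _ G' G dir_removeS bidir_removeS.
case: ifP => XW; apply/idP/idP => WS.
- rewrite eqEsubset !sub1set XW andbT; apply/subsetP=> y yW; apply/set1P.
  exact: (isolated_linked isolated_remove (param_set_linked WS XW yW)).
- by rewrite (eqP WS) set1_param.
- have [x xW] : exists x, x \in W.
    by case/param_setP: WS => x /anP[w wW _] _; exists w.
  apply: (linked_param_set xW) => u v uW vW _; apply: lk (param_set_linked WS uW vW).
  exact: an_subgraph dir_removeS _.
have [x xW] : exists x, x \in W.
  by case/param_setP: WS => x /anP[w wW _] _; exists w.
have nX w : w \in W -> w != X by apply: contraTneq => ->; rewrite XW.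
apply: (linked_param_set xW) => u v uW vW _.
have XW' : X \notin W by rewrite XW.
have inan w : w \in W -> w \in an G W by apply/subsetP/sub_an.
rewrite an_remove //; apply: linked_remove; rewrite ?nX //; try exact: inan.
- by move=> y z; apply: an_dir.
- exact: an_child.
exact: param_set_linked.
Qed.

End Removal.

(** * Markov equivalence *)

Lemma param_set_adjacent (V : finType) (G1 G2 : admg V) (u v : V) :
  adjacent_linked G2 -> param_set G1 = param_set G2 ->
  adjacent G1 u v -> adjacent G2 u v.
Proof.
move=> m2 eS uv; apply: m2; first exact: adjacent_neq uv.
by apply: param_set_linked; rewrite ?set21 ?set22 // -eS param_set2.
Qed.

(** [W] is [u], [v] and the whole bidirected component behind the link. Through S it carries the
    link to the other graph, where its members, being non-isolated, can be placed in the relevant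
    ancestral set. *)
Lemma linked_param_witness (V : finType) (G : admg V) (D : {set V}) (u v : V) :
  u != v -> linked G D u v ->
  exists W : {set V}, [/\ W \in param_set G, u \in W, v \in W &
                          forall w, w \in W -> ~~ isolated G w].
Proof.
move=> uv /linkedP[x [xD ux vx]].
pose K := [set y | connect (induced_bidir G D) x y].
have xK : x \in K by rewrite inE connect0.
have KK y : connect (induced_bidir G D) x y -> connect (induced_bidir G K) x y.
  move=> /connectP[p + ->] {y}; elim/last_ind: p => [//|p y IH].
  rewrite rcons_path last_rcons => /andP[pp py]; apply: connect_trans (IH pp) _.
  have xl : connect (induced_bidir G D) x (last x p) by apply/connectP; exists p.
  apply: connect1; rewrite /induced_bidir /= !inE xl (connect_trans xl (connect1 py)).
  by case/and3P: py.
pose W := [set u; v] :|: K.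
have KW : K \subset an G W := subset_trans (subsetUr _ _) (sub_an G W).
have sub : W \subset ext G K x.
  rewrite !subUset !sub1set -!andbA; apply/and3P; split.
  - by case/extP: ux => y xy uy; apply/extP; exists y => //; apply: KK.
  - by case/extP: vx => y xy vy; apply/extP; exists y => //; apply: KK.
  by apply/subsetP=> y; rewrite inE => /KK xy; apply/extP; exists y; auto.
exists W; rewrite !inE !eqxx orbT; split=> //.
  apply/param_setP; exists x; first exact: (subsetP KW).
  exact: subset_trans sub (extS _ _ KW).
move=> w /(subsetP sub) wx; apply/negP=> iw; case/eqP: uv.
have lw y : y \in W -> y = w.
  move=> /(subsetP sub) yx; apply: (isolated_linked (D := K) iw).
  by apply/linkedP; exists x.
have uW : u \in W by rewrite in_setU set21.
have vW : v \in W by rewrite in_setU set22.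
exact: etrans (lw u uW) (esym (lw v vW)).
Qed.

(* Induction on the number of non-isolated vertices of [G1]: either they are all
   ancestors of [a], [b] and [C] in [G1], and then every linked pair of [G2] is
   linked in [G1], or a sink of [G1] can be removed from both graphs. *)
Lemma augmented_transfer (V : finType) (G1 G2 : admg V) (C : {set V}) (a b : V) :
  adjacent_linked G1 -> ancestral G1 -> adjacent_linked G2 -> ancestral G2 ->
  param_set G1 = param_set G2 ->
  connect (augmented G2 C (an G2 (a |: (b |: C)))) a b ->
  connect (augmented G1 C (an G1 (a |: (b |: C)))) a b.
Proof.
have [n] := ubnP #|[set x | ~~ isolated G1 x]|.
elim: n G1 G2 => [//|n IH] G1 G2 lt_n m1 a1 m2 a2 eS; set B := a |: (b |: C).
have [all_an|] := boolP [forall x, ~~ isolated G1 x ==> (x \in an G1 B)].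
  apply: connect_sub => u v /and3P[/setDP[_ uC] /setDP[_ vC] luv].
  have [->|uv] := eqVneq u v; first exact: connect0.
  have [W [WS uW vW niW]] := linked_param_witness uv luv.
  have WB : W \subset an G1 B.
    apply/subsetP=> w /niW/isolatedPn[y wy].
    apply: (implyP (forallP all_an w)); apply/isolatedPn; exists y.
    exact: param_set_adjacent m1 (esym eS) wy.
  apply: connect1; apply/and3P; rewrite !inE uC vC !(subsetP WB) //; split=> //.
  apply: linkedS (an_sub_an WB) _.
  by apply: param_set_linked; rewrite ?eS.
rewrite negb_forall => /existsP[x0]; rewrite negb_imply => Px0.
have [X /andP[niX XB] Xmax] :=
  @maximal_descendant _ G1 [pred x | ~~ isolated G1 x && (x \notin an G1 B)] x0 Px0.
have sink y : ~~ dir G1 X y.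
  apply/negP=> Xy; case/negP: (Xmax y Xy); rewrite /=; apply/andP; split.
    by apply/isolatedPn; exists X; rewrite adjacent_sym dir_adjacent.
  by apply: contra XB; apply: an_dir.
have uc1 := sink_union_closed sink.
(* In [G2] the vertex [X] may have children; it is union closure that S transfers. *)
have uc2 : union_closed_at G2 X by rewrite /union_closed_at -eS.
have XB' : X \notin B by apply: contra XB; apply/subsetP/sub_an.
rewrite (connect_augmented_remove m1 a1 uc1 XB') (connect_augmented_remove m2 a2 uc2 XB').
apply: IH; try exact: adjacent_linked_remove; try exact: ancestral_remove.
  rewrite ltnS in lt_n; apply: leq_trans lt_n; apply: proper_card; apply/properP; split.
    apply/subsetP=> x; rewrite !inE => /isolatedPn[y]; rewrite adjacent_remove.
    by move=> /and3P[_ _ xy]; apply/isolatedPn; exists y.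
  by exists X; rewrite !inE // isolated_remove.
by apply/setP=> W; rewrite (param_set_remove m1 a1 uc1) (param_set_remove m2 a2 uc2) eS.
Qed.

Lemma m_separated_set1 (V : finType) (G : admg V) (C : {set V}) (a b : V) :
  a != b -> a \notin C -> b \notin C ->
  m_separated G [set a] [set b] C <-> ~ connecting G C a b.
Proof.
move=> ab aC bC; split=> [[_ _ _ _ sep]|nc]; first exact: sep (set11 _) (set11 _).
split; rewrite ?disjoints1 ?inE //; first by split; apply/set0Pn; eexists; exact: set11.
by move=> x y /set1P-> /set1P->.
Qed.

Lemma connecting_dec (V : finType) (G : admg V) (C : {set V}) (a b : V) :
  a \notin C -> b \notin C -> ~ ~ connecting G C a b -> connecting G C a b.
Proof.
move=> aC bC nn; apply/(connectingP _ aC bC); apply: contraT => /negP nc.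
by case: nn => /(connectingP _ aC bC).
Qed.

Lemma markov_equivalentP (V : finType) (G1 G2 : admg V) :
  markov_equivalent G1 G2 <->
  (forall (C : {set V}) (a b : V), a != b -> a \notin C -> b \notin C ->
     connecting G1 C a b <-> connecting G2 C a b).
Proof.
split=> [me C a b ab aC bC|h A B C].
  have e : ~ connecting G1 C a b <-> ~ connecting G2 C a b.
    by split=> /m_separated_set1-/(_ ab aC bC)/me/m_separated_set1; apply.
  by split=> c; apply: connecting_dec => // nc; case/e: nc.
split=> -[n0 dAB dAC dBC sep]; split=> // a b aA bB; have := sep a b aA bB;
  have ab : a != b by [apply: contraTneq aA => ->; rewrite (disjointFl dAB)];
  have aC : a \notin C by [rewrite (disjointFr dAC)];
  have bC : b \notin C by [rewrite (disjointFr dBC)];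
  move=> ns /(h C a b ab aC bC); exact: ns.
Qed.

(** When [C] contains the rest of [W], the ancestors of [u], [v] and [C] include an(W), where [u]
    and [v] are linked. *)
Lemma param_set_connecting (V : finType) (G : admg V) (W : {set V}) :
  W \in param_set G <->
  W != set0 /\
  forall (C : {set V}) (u v : V), u \in W -> v \in W -> u != v ->
    u \notin C -> v \notin C ->
    W :\: [set u; v] \subset C -> connecting G C u v.
Proof.
split=> [WS|[/set0Pn[w wW] h]].
  split; first by case/param_setP: WS => x /anP[w wW _] _; apply/set0Pn; exists w.
  move=> C u v uW vW uv uC vC sC; apply/(connectingP _ uC vC)/connect1.
  have WB : W \subset an G (u |: (v |: C)).
    apply: subset_trans (sub_an _ _); apply/subsetP=> w wW; rewrite !inE.
    have [//|wu] := eqVneq w u; have [//|wv] := eqVneq w v.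
    by rewrite (subsetP sC) // !inE wW (negPf wu) (negPf wv).
  apply/and3P; rewrite !inE uC vC !(subsetP WB) //; split=> //.
  exact: linkedS (an_sub_an WB) (param_set_linked WS uW vW).
apply: (linked_param_set wW) => u v uW vW uv; set A := an G W.
(* Conditioning on all of an(W) but [u] and [v] leaves a chain only these two vertices, so one of
   its steps links them directly. *)
pose C := A :\: [set u; v].
have uC : u \notin C by rewrite !inE eqxx.
have vC : v \notin C by rewrite !inE eqxx orbT.
have sA : an G (u |: (v |: C)) \subset A.
  apply: an_sub_an; rewrite !subUset !sub1set !(subsetP (sub_an G W)) //=.
  exact: subsetDl.
have /(connectingP _ uC vC)/connectP[p pp vE] := h C u v uW vW uv uC vC
  (setSD _ (sub_an _ _)).
elim: p pp vE => [_ vE|z p IHp /= /andP[uz pz] vE]; first by rewrite vE eqxx in uv.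
move: uz => /and3P[_ /setDP[zA zC] luz].
have zuv : z \in [set u; v].
  by move: zC; rewrite in_setD (subsetP sA _ zA) andbT negbK.
case/set2P: zuv => [zu|<-]; last exact: linkedS sA luz.
by rewrite zu in pz vE; apply: IHp.
Qed.

Theorem theorem3p2 (V : finType) (G1 G2 : admg V) :
  is_mag G1 -> is_mag G2 ->
  (markov_equivalent G1 G2 <-> param_set G1 = param_set G2).
Proof.
move=> [/maximal_adjacent_linked m1 a1] [/maximal_adjacent_linked m2 a2]; split.
  move=> /markov_equivalentP me; apply/setP=> W.
  by apply/idP/idP => /param_set_connecting[W0 h]; apply/param_set_connecting;
     split=> // C u v uW vW uv uC vC sC; apply/(me C u v uv uC vC); apply: h.
move=> eS; apply/markov_equivalentP => C a b ab aC bC.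
split=> /(connectingP _ aC bC) c; apply/(connectingP _ aC bC).
  exact: (augmented_transfer m2 a2 m1 a1 (esym eS) c).
exact: (augmented_transfer m1 a1 m2 a2 eS c).
Qed.
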